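(* Let $N\ge 1$ be an integer and $p\in(0,1)$. Let $X$ denote the number of isolated vertices in the random bipartite graph $G_{N,N,p}$ with vertex classes $V_1,V_2$ of size $N$ each, and put $V=V_1\cup V_2$. For $v\in V$ let $I_v$ be the indicator random variable of the event that $v$ is isolated in $G_{N,N,p}$, so that $X=\sum_{v\in V}I_v$, and define $$\mu:=\mathbb{E}X=\sum_{v\in V}\mathbb{E}I_v,\qquad \Delta:=\sum_{v\in V}\ \sum_{w\in V:\,w\sim v}\mathbb{E}(I_vI_w),$$ where $w\sim v$ means that $v$ and $w$ lie in different vertex classes. Then $$\mathbb{P}(X=0)\le e^{-\mu+\Delta p\cdot\log(1+\mu/(\Delta p))},$$ and, if $\mathbb{P}(I_v=1)\le 1/2$ (a probability which is the same for all $v\in V$), then also $$e^{-\mu-\mu^2/(2N)}\le \mathbb{P}(X=0).$$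
   Context: $G_{N,N,p}$ is the binomial random bipartite graph with disjoint vertex classes $V_1$ and $V_2$, $|V_1|=|V_2|=N$, in which each of the $N^2$ pairs in $V_1\times V_2$ is included as an edge independently with probability $p$ (and there are no edges inside $V_1$ or $V_2$). A vertex is isolated if it has no neighbors. The logarithm is the natural logarithm. *)

(* Defs.v *)
From mathcomp Require Import all_boot all_order all_algebra.
From mathcomp Require Import reals.
Set Implicit Arguments.
Unset Strict Implicit.
Unset Printing Implicit Defensive.
Import Order.TTheory GRing.Theory Num.Theory.
Local Open Scope ring_scope.

(* V = V_1 + V_2, with inl for V_1 and inr for V_2. *)
Notation vertex N := ('I_N + 'I_N)%type.

(* w ~ v: this does not depend on the graph. *)
Definition opposite (N : nat) (v w : vertex N) : bool :=
  match v, w with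
  | inl _, inr _ | inr _, inl _ => true
  | _, _ => false
  end.

(* A bipartite graph with classes V_1, V_2 is its edge set in V_1 x V_2. *)
Notation bigraph N := {set 'I_N * 'I_N}.

Definition adj (N : nat) (G : bigraph N) (v w : vertex N) : bool :=
  match v, w with
  | inl i, inr j => (i, j) \in G
  | inr j, inl i => (i, j) \in G
  | _, _ => false
  end.

Definition isolated (N : nat) (G : bigraph N) (v : vertex N) : bool :=
  [forall w : vertex N, ~~ adj G v w].

(* The law of G_{N,N,p}: the N^2 edge indicators are independent
   Bernoulli(p), so each graph has the product weight. *)
Definition bigraph_mass (R : realType) (N : nat) (p : R) (G : bigraph N) : R :=
  \prod_(e : 'I_N * 'I_N) (if e \in G then p else 1 - p).

Definition Prob (R : realType) (N : nat) (p : R) (A : pred (bigraph N)) : R :=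
  \sum_(G : bigraph N | A G) bigraph_mass p G.

Definition Expect (R : realType) (N : nat) (p : R) (f : bigraph N -> R) : R :=
  \sum_(G : bigraph N) bigraph_mass p G * f G.

Definition isol_ind (R : realType) (N : nat) (v : vertex N) (G : bigraph N) : R :=
  (isolated G v)%:R.

Definition num_isolated (N : nat) (G : bigraph N) : nat :=
  #|[set v : vertex N | isolated G v]|.

Definition mu (R : realType) (N : nat) (p : R) : R :=
  Expect p (fun G : bigraph N => (num_isolated G)%:R).

Definition Delta (R : realType) (N : nat) (p : R) : R :=
  \sum_(v : vertex N) \sum_(w : vertex N | opposite v w)
    Expect p (fun G => isol_ind R v G * isol_ind R w G).

Lemma Prob_total (R : realType) (N : nat) (p : R) :
  Prob p (fun _ : bigraph N => true) = 1.
Proof.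
rewrite /Prob /bigraph_mass.
transitivity (\prod_(e : 'I_N * 'I_N) (p + (1 - p))); last first.
  by rewrite big1 // => e _; rewrite addrC subrK.
rewrite bigA_distr.
by [].
Qed.

Lemma num_isolatedE (R : realType) (N : nat) (G : bigraph N) :
  (num_isolated G)%:R = \sum_(v : vertex N) isol_ind R v G.
Proof.
rewrite /num_isolated -sum1_card natr_sum big_mkcond /=.
by apply: eq_bigr => v _; rewrite inE /isol_ind; case: isolated.
Qed.

Lemma muE (R : realType) (N : nat) (p : R) :
  mu N p = \sum_(v : vertex N) Expect p (isol_ind R v).
Proof.
rewrite /mu /Expect exchange_big /=; apply: eq_bigr => G _.
by rewrite num_isolatedE mulr_sumr.
Qed.

Lemma isolatedE (N : nat) (G : bigraph N) (v : vertex N) :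
  isolated G v = [forall e : 'I_N * 'I_N,
    (match v with inl i => e.1 == i | inr j => e.2 == j end) ==> (e \notin G)].
Proof.
apply/forallP/forallP; case: v => i H.
- by case=> a b /=; apply/implyP => /eqP ->; exact: H (inr b).
- by case=> a b /=; apply/implyP => /eqP ->; exact: H (inl a).
- by case=> [//|b] /=; have := H (i, b); rewrite /= eqxx.
- by case=> [a|//] /=; have := H (a, i); rewrite /= eqxx.
Qed.

Lemma Prob_isolated (R : realType) (N : nat) (p : R) (v : vertex N) :
  Prob p (fun G : bigraph N => isol_ind R v G == 1) = (1 - p) ^+ N.
Proof.
pose P (e : 'I_N * 'I_N) :=
  match v with inl i => e.1 == i | inr j => e.2 == j end.
transitivity (\prod_(e : 'I_N * 'I_N) ((if P e then 0 else p) + (1 - p))).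
  rewrite bigA_distr /Prob big_mkcond /=; apply: eq_bigr => G _.
  rewrite /isol_ind isolatedE -/P pnatr_eq1 eqb1; case: forallP => [H|/forallP].
    apply: eq_bigr => e _; have := H e; rewrite -/(P e).
    by case: (e \in G) => //; rewrite implybF => /negbTE ->.
  rewrite negb_forall => /existsP[e]; rewrite negb_imply negbK => /andP[Pe eG].
  by rewrite (bigD1 e) //= eG /P Pe mul0r.
rewrite (bigID P) /= [X in _ * X]big1 ?mulr1; last first.
  by move=> e /negbTE ->; rewrite addrC subrK.
rewrite (eq_bigr (fun=> 1 - p)); last by move=> e ->; rewrite add0r.
rewrite prodr_const; congr (_ ^+ _); rewrite /P; case: v {P} => i.
- rewrite -[RHS](card_ord N) -(card_image (f := fun b : 'I_N => (i, b))) //;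
    last by move=> a b [].
  apply: eq_card => -[a b]; rewrite [LHS]unfold_in /=; apply/eqP/imageP.
    by move=> ->; exists b.
  by case=> c _ [].
- rewrite -[RHS](card_ord N) -(card_image (f := fun b : 'I_N => (b, i))) //;
    last by move=> a b [].
  apply: eq_card => -[a b]; rewrite [LHS]unfold_in /=; apply/eqP/imageP.
    by move=> ->; exists a.
  by case=> c _ [].
Qed.

(* Main.v *)
Require Import Defs.
From mathcomp Require Import all_boot all_order all_algebra.
From mathcomp Require Import reals sequences exp.
From mathcomp Require Import ring lra.
Set Implicit Arguments.
Unset Strict Implicit.
Unset Printing Implicit Defensive.
Import Order.TTheory GRing.Theory Num.Theory.
Local Open Scope ring_scope.

(* Put q = 1 - p, x = q^N and b = N p q^(N-1), so that mu = 2 N x and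
   Delta p = mu b.  Call the classes rows and columns of the random matrix of
   edges, and require first that no row is isolated, then add the columns one at
   a time.  An isolated column leaves a matrix with one column less, so the
   probability F_M(j) that, with M columns, no row and none of the first j
   columns is isolated satisfies F_M(j+1) = F_M(j) - x F_(M-1)(j).
   Since F_(M-1)(j) <= F_M(j), each column costs at most a factor 1 - x, whence
   P(X = 0) >= (1 - x)^(2N).  Conversely, given that no row is isolated, columns
   are negatively correlated, so F_(M-1)(j) >= rho F_M(j) with
   rho = ((1 - q^(N-1)) / (1 - q^N))^N >= 1 - b / (1 - x) when M = N, and
   P(X = 0) <= (1 - x)^N (1 - x rho)^N.  It remains to compare the N-th roots,
   for which x (1 - x) <= b <= 1 - x suffices. *)

(** * Inclusion-exclusion over rows and columns *)

Lemma natr_forall (R : comNzRingType) (I : finType) (P : pred I) :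
  [forall i, P i]%:R = \prod_i (P i)%:R :> R.
Proof.
case: forallP => [P_all|/forallP].
  by rewrite big1 // => i _; rewrite P_all.
rewrite negb_forall => /existsP[i /negbTE nPi].
by rewrite (bigD1 i) //= nPi mul0r.
Qed.

Lemma isol_ind_inl (R : realType) (N : nat) (i : 'I_N) (G : bigraph N) :
  isol_ind R (inl i) G = \prod_(j < N) ((i, j) \notin G)%:R.
Proof.
rewrite -natr_forall /isol_ind; congr (nat_of_bool _)%:R.
apply/forallP/forallP => [H j|H [//|j]]; [exact: (H (inr j))|exact: H].
Qed.

Lemma isol_ind_inr (R : realType) (N : nat) (j : 'I_N) (G : bigraph N) :
  isol_ind R (inr j) G = \prod_(i < N) ((i, j) \notin G)%:R.
Proof.
rewrite -natr_forall /isol_ind; congr (nat_of_bool _)%:R.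
apply/forallP/forallP => [H i|H [i|//]]; [exact: (H (inl i))|exact: H].
Qed.

(** All pairs meeting [S] or [T] must be absent; counted column by column, these are [N] pairs in a
    column of [T] and [#|S|] pairs in any other. *)
Lemma Expect_isol_ind_sets (R : realType) (N : nat) (p : R) (S T : {set 'I_N}) :
  Expect p (fun G => (\prod_(i in S) isol_ind R (inl i) G) *
                     \prod_(j in T) isol_ind R (inr j) G) =
  \prod_(j < N) (if j \in T then (1 - p) ^+ N else (1 - p) ^+ #|S|).
Proof.
pose t (e : 'I_N * 'I_N) := (e.1 \in S) || (e.2 \in T).
transitivity (\prod_e ((if t e then 0 else p) + (1 - p))).
  rewrite bigA_distr; apply: eq_bigr => G _.
  have -> : (\prod_(i in S) isol_ind R (inl i) G) *
            \prod_(j in T) isol_ind R (inr j) G =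
            \prod_e (if t e then (e \notin G)%:R else 1).
    rewrite big_mkcond [X in _ * X]big_mkcond /=.
    transitivity
      ((\prod_(i < N) \prod_(j < N) if i \in S then ((i, j) \notin G)%:R else 1)
       * \prod_(j < N) \prod_(i < N)
           if j \in T then ((i, j) \notin G)%:R else 1 : R).
      congr (_ * _); apply: eq_bigr => k _; case: ifP => _.
      - by rewrite isol_ind_inl.
      - by rewrite big1.
      - by rewrite isol_ind_inr.
      - by rewrite big1.
    rewrite [X in _ * X]exchange_big !pair_bigA -big_split /=.
    apply: eq_bigr => -[i j] _ /=; rewrite /t /=.
    case: (i \in S); case: (j \in T); rewrite ?mulr1 ?mul1r //.
    by case: (_ \notin _); rewrite ?mulr1 ?mulr0.
  rewrite /bigraph_mass -big_split /=; apply: eq_bigr => e _.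
  by case: (e \in G) => /=; case: (t e); rewrite ?mulr0 ?mulr1.
rewrite -(pair_bigA _ (fun i j => (if t (i, j) then 0 else p) + (1 - p))) /=.
rewrite exchange_big /=; apply: eq_bigr => j _; rewrite /t /=.
case: ifP => _.
  under eq_bigr do rewrite orbT add0r.
  by rewrite prodr_const card_ord.
under eq_bigr do rewrite orbF.
rewrite (bigID (mem S)) /= [X in _ * X]big1 ?mulr1; last first.
  by move=> i /negbTE ->; rewrite addrC subrK.
under eq_bigr => i -> do rewrite add0r.
by rewrite prodr_const.
Qed.

(** Inclusion-exclusion over sets [S] of rows and [T] of columns. For fixed [S] the columns
    contribute independent factors, so the sum over [T] folds back into an [N]-th power. *)
Lemma Prob_no_isolatedE (R : realType) (N : nat) (p : R) :
  Prob p (fun G : bigraph N => num_isolated G == 0%N) =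
  \sum_(S : {set 'I_N}) (-1) ^+ #|S| * ((1 - p) ^+ #|S| - (1 - p) ^+ N) ^+ N.
Proof.
transitivity (Expect p (fun G : bigraph N =>
    (\prod_(i < N) (- isol_ind R (inl i) G + 1)) *
     \prod_(j < N) (- isol_ind R (inr j) G + 1))).
  rewrite /Prob big_mkcond; apply: eq_bigr => G _ /=.
  rewrite /num_isolated cards_eq0; case: eqP => [/setP G0|/eqP/set0Pn[v]].
    have I0 v : isol_ind R v G = 0.
      by rewrite /isol_ind; have := G0 v; rewrite !inE => ->.
    by rewrite !big1 ?mulr1 // => i _; rewrite I0 oppr0 add0r.
  rewrite inE => Gv; have I1 : isol_ind R v G = 1 by rewrite /isol_ind Gv.
  case: v I1 {Gv} => i I1.
    by rewrite [X in _ * (X * _)](bigD1 i) //= I1 addNr !mul0r mulr0.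
  by rewrite [X in _ * (_ * X)](bigD1 i) //= I1 addNr mul0r !mulr0.
rewrite /Expect.
have expand (f : 'I_N -> R) : \prod_i (- f i + 1) =
    \sum_(S : {set 'I_N}) (-1) ^+ #|S| * \prod_(i in S) f i.
  rewrite bigA_distr; apply: eq_bigr => S _.
  by rewrite -big_mkcond /= prodrN.
under eq_bigr do rewrite !expand big_distrlr /= mulr_sumr.
rewrite exchange_big; apply: eq_bigr => S _ /=.
under eq_bigr do rewrite mulr_sumr.
rewrite exchange_big /=.
transitivity (\sum_(T : {set 'I_N}) (-1) ^+ #|S| * ((-1) ^+ #|T| *
    \prod_(j < N) (if j \in T then (1 - p) ^+ N else (1 - p) ^+ #|S|))).
  apply: eq_bigr => T _; rewrite -Expect_isol_ind_sets /Expect 2!mulr_sumr.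
  by apply: eq_bigr => G _; ring.
rewrite -mulr_sumr; congr (_ * _).
transitivity (\prod_(j < N) (- (1 - p) ^+ N + (1 - p) ^+ #|S|)).
  rewrite bigA_distr; apply: eq_bigr => T _.
  rewrite -prodr_const [X in X * _]big_mkcond -big_split /=.
  by apply: eq_bigr => j _; case: ifP => _; rewrite ?mulN1r ?mul1r.
by rewrite prodr_const card_ord addrC.
Qed.

(** * Recursions and monotonicity of [filled] *)

(* Since [filled] satisfies [filled_col] and has value [(1 - q ^+ m) ^+ n] at
   [j = 0], it is, for [j <= m], the probability that an [n] x [m] matrix with
   independent entries, each of them zero with probability [q], has no zero row
   and no zero column among its first [j] columns. *)
Definition filled (R : comNzRingType) (q : R) (n m j : nat) : R :=
  \sum_(i < n.+1)
     'C(n, i)%:R * ((-1) ^+ i * q ^+ (m * i)) * (1 - q ^+ (n - i)) ^+ j.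

(* The mean of [g k], with [k] the number of zeros among [j] row entries. *)
Definition bin_mean (R : comNzRingType) (q : R) (g : nat -> R) (j : nat) : R :=
  \sum_(k < j.+1) ((1 - q) ^+ (j - k) * q ^+ k) *+ 'C(j, k) * g k.

Lemma filled_col (R : comNzRingType) (q : R) (n m j : nat) :
  filled q n m.+1 j.+1 = filled q n m.+1 j - q ^+ n * filled q n m j.
Proof.
rewrite /filled mulr_sumr -sumrB; apply: eq_bigr => i _.
have -> : q ^+ n = q ^+ (n - i) * q ^+ i by rewrite -exprD subnK // -ltnS.
by rewrite mulSn exprD [_ ^+ j.+1]exprS; ring.
Qed.

(** Condition on the new row: if [k] of its first [j] entries are zero, only those [k] columns still
    need a nonzero entry elsewhere. The subtracted term removes the case of a zero row. *)
Lemma filled_row (R : comNzRingType) (q : R) (n m j : nat) :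
  filled q n.+1 m j = bin_mean q (filled q n m) j - q ^+ m * filled q n m j.
Proof.
have -> : bin_mean q (filled q n m) j =
    \sum_(i < n.+1) 'C(n, i)%:R * ((-1) ^+ i * q ^+ (m * i)) *
                    (1 - q ^+ (n.+1 - i)) ^+ j.
  rewrite /bin_mean /filled; under eq_bigr do rewrite mulr_sumr.
  rewrite exchange_big; apply: eq_bigr => i _ /=.
  rewrite subSn -1?ltnS // exprS.
  (* This splitting makes the binomial theorem produce the weights of [bin_mean]. *)
  rewrite (_ : 1 - q * _ = (1 - q) + q * (1 - q ^+ (n - i))); last by ring.
  rewrite exprDn mulr_sumr; apply: eq_bigr => k _.
  by rewrite -[_ *+ 'C(j, k)]mulr_natr exprMn; ring.
rewrite /filled mulr_sumr big_ord_recl [in RHS]big_ord_recl /=.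
rewrite !bin0 -addrA; congr (_ + _).
(* Pascal's rule: one half completes the [bin_mean] sum, the other is the subtracted term with its
   index shifted by one. *)
under eq_bigr do rewrite /bump /= !add1n binS natrD !mulrDl.
rewrite big_split /= big_ord_recr /= bin_small // !mul0r addr0.
congr (_ + _).
rewrite -sumrN; apply: eq_bigr => i _.
by rewrite subSS mulnS exprD [(-1) ^+ _]exprS; ring.
Qed.

Lemma bin_mean_le (R : realDomainType) (q : R) (f g : nat -> R) (j : nat)
    (q_ge0 : 0 <= q) (q_le1 : q <= 1) :
  (forall k, (k <= j)%N -> f k <= g k) -> bin_mean q f j <= bin_mean q g j.
Proof.
move=> fg; apply: ler_sum => k _; rewrite ler_wpM2l //.
  by rewrite mulrn_wge0 // mulr_ge0 ?exprn_ge0 ?subr_ge0.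
by rewrite fg // -ltnS.
Qed.

Lemma bin_mean_ge (R : realDomainType) (q : R) (g : nat -> R) (j : nat)
    (q_ge0 : 0 <= q) (q_le1 : q <= 1) :
  (forall k, (k <= j)%N -> g j <= g k) -> g j <= bin_mean q g j.
Proof.
move=> gj; apply: le_trans (_ : bin_mean q (fun=> g j) j <= _); last first.
  exact: bin_mean_le.
by rewrite /bin_mean -mulr_suml -exprDn subrK expr1n mul1r.
Qed.

(* For [j <= m] the subtracted term only lowers the coefficient [q ^+ j] of
   [g j] in [bin_mean q g j], and keeps it nonnegative. *)
Lemma bin_mean_sub_le (R : realDomainType) (q : R) (f g : nat -> R) (m j : nat)
    (q_ge0 : 0 <= q) (q_le1 : q <= 1) :
  (j <= m)%N -> (forall k, (k <= j)%N -> f k <= g k) ->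
  bin_mean q f j - q ^+ m * f j <= bin_mean q g j - q ^+ m * g j.
Proof.
move=> jm fg; rewrite lerBlDr addrAC -lerBlDr opprK.
rewrite /bin_mean !big_ord_recr /= subnn expr0 mul1r binn mulr1n.
have qmj : q ^+ m <= q ^+ j by apply: ler_wiXn2l.
have fgj := fg j (leqnn j).
suff : \sum_(k < j) ((1 - q) ^+ (j - k) * q ^+ k) *+ 'C(j, k) * f k <=
       \sum_(k < j) ((1 - q) ^+ (j - k) * q ^+ k) *+ 'C(j, k) * g k by nra.
apply: ler_sum => k _; rewrite ler_wpM2l ?fg 1?ltnW //.
by rewrite mulrn_wge0 // mulr_ge0 ?exprn_ge0 ?subr_ge0.
Qed.

Lemma filled_0n (R : comNzRingType) (q : R) (m j : nat) :
  filled q 0 m j = 0 ^+ j.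
Proof. by rewrite /filled big_ord1 muln0 !expr0 subrr !mul1r. Qed.

Lemma filled_j0 (R : comNzRingType) (q : R) (n m : nat) :
  filled q n m 0 = (1 - q ^+ m) ^+ n.
Proof.
rewrite /filled exprBn; apply: eq_bigr => i _.
by rewrite expr0 mulr1 expr1n mulr1 exprM mulr_natl.
Qed.

Lemma filled_ge0 (R : realDomainType) (q : R) (n m j : nat)
    (q_ge0 : 0 <= q) (q_le1 : q <= 1) : (j <= m)%N -> 0 <= filled q n m j.
Proof.
elim: n m j => [|n IHn] m j jm; first by rewrite filled_0n exprn_ge0.
rewrite filled_row.
have := @bin_mean_sub_le _ q (fun=> 0) (filled q n m) m j q_ge0 q_le1 jm.
rewrite /bin_mean mulr0 subr0 big1 => [|k _]; last by rewrite mulr0.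
by apply=> k kj; apply: IHn; apply: leq_trans jm.
Qed.

(** An extra column with no demand on it only helps the rows: in the row recursion it also lowers
    the coefficient [q ^+ m] of the subtracted term. *)
Lemma filled_le_col (R : realDomainType) (q : R) (n m j : nat)
    (q_ge0 : 0 <= q) (q_le1 : q <= 1) :
  (j <= m)%N -> filled q n m j <= filled q n m.+1 j.
Proof.
elim: n j => [|n IHn] j jm; first by rewrite !filled_0n.
rewrite !filled_row.
set A := filled q n m.+1.
apply: le_trans (_ : bin_mean q A j - q ^+ m * A j <= _).
  by apply: bin_mean_sub_le => // k kj; apply: IHn; apply: leq_trans jm.
rewrite lerB // ler_wpM2r ?filled_ge0 1?leqW //.
by apply: ler_wiXn2l.
Qed.

Lemma filled_decr (R : realDomainType) (q : R) (n m j k : nat)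
    (q_ge0 : 0 <= q) (q_le1 : q <= 1) :
  (k <= j <= m)%N -> filled q n m j <= filled q n m k.
Proof.
case/andP=> kj; elim: j kj => [|j IHj]; first by rewrite leqn0 => /eqP ->.
rewrite leq_eqVlt => /predU1P[-> //|]; rewrite ltnS => kj.
case: m IHj => // m IHj jm; apply: le_trans (IHj kj (ltnW jm)).
rewrite filled_col lerBlDr lerDl mulr_ge0 ?filled_ge0 //.
by rewrite exprn_ge0.
Qed.

(* [filled q n m j / (1 - q ^+ m) ^+ n] is the probability that the first [j]
   columns are nonzero given that no row is zero; an additional column can only
   decrease it, as it relieves the others from keeping the rows nonzero. *)
Lemma filled_ratio (R : realDomainType) (q : R) (n m j : nat)
    (q_ge0 : 0 <= q) (q_le1 : q <= 1) : (j <= m)%N ->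
  (1 - q ^+ m) ^+ n * filled q n m.+1 j <=
  (1 - q ^+ m.+1) ^+ n * filled q n m j.
Proof.
elim: n j => [|n IHn] j jm; first by rewrite !filled_0n.
rewrite !filled_row.
set c := q ^+ m; set d := q ^+ m.+1.
set A := filled q n m.+1; set B := filled q n m.
have c1 : 0 <= 1 - c by rewrite subr_ge0 exprn_ile1.
have dc : d <= c by apply: ler_wiXn2l.
have TB : B j <= bin_mean q B j.
  by apply: bin_mean_ge => // k kj; apply: filled_decr => //; rewrite kj.
have step : (1 - c) ^+ n * (bin_mean q A j - d * A j) <=
            (1 - d) ^+ n * (bin_mean q B j - d * B j).
  have scale a (g : nat -> R) : a * (bin_mean q g j - d * g j) =
      bin_mean q (fun k => a * g k) j - d * (a * g j).
    rewrite mulrBr /bin_mean mulr_sumr mulrCA; congr (_ - _).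
    by apply: eq_bigr => k _; rewrite mulrCA.
  rewrite !scale; apply: bin_mean_sub_le => //; first exact: leqW.
  by move=> k kj; apply: IHn; apply: leq_trans jm.
rewrite !exprS -!mulrA.
apply: le_trans (ler_wpM2l c1 step) _.
rewrite mulrCA [leRHS]mulrCA ler_wpM2l ?exprn_ge0 //; first by lra.
(* With [T = bin_mean q B j], the right side minus the left is [(c - d) * (T - B j)]. *)
nra.
Qed.

(** * Product bounds on [filled], and elementary bounds on powers *)

Lemma filled_lower (R : realDomainType) (q : R) (n m j : nat)
    (q_ge0 : 0 <= q) (q_le1 : q <= 1) : (j <= m)%N ->
  (1 - q ^+ m) ^+ n * (1 - q ^+ n) ^+ j <= filled q n m j.
Proof.
elim: j => [|j IHj] jm; first by rewrite filled_j0 mulr1.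
case: m jm IHj => // m jm /(_ (ltnW jm)) IHj.
rewrite filled_col [_ ^+ j.+1]exprSr mulrA.
have q0 : 0 <= q ^+ n by rewrite exprn_ge0.
have q1 : q ^+ n <= 1 by rewrite exprn_ile1.
apply: le_trans (ler_wpM2r _ IHj) _; first by rewrite subr_ge0.
by rewrite mulrBr mulr1 lerB // mulrC ler_wpM2r ?filled_le_col.
Qed.

(** In [1 - x^n = (1 - x) (1 + x + ... + x^(n-1))] every summand lies between [x^(n-1)] and 1. The
    two resulting bounds later give [x (1 - x) <= b <= 1 - x]. *)
Lemma one_sub_expn_le (R : realDomainType) (x : R) (n : nat) :
  0 <= x <= 1 -> 1 - x ^+ n <= n%:R * (1 - x).
Proof.
move=> /andP[x0 x1]; elim: n => [|n IHn]; first by rewrite expr0 subrr mul0r.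
rewrite exprSr -[n.+1]addn1 natrD mulrDl mul1r.
have : 0 <= x ^+ n by rewrite exprn_ge0.
have : x ^+ n <= 1 by rewrite exprn_ile1.
by nra.
Qed.

Lemma one_sub_expn_ge (R : realDomainType) (x : R) (n : nat) :
  0 <= x <= 1 -> n%:R * x ^+ n.-1 * (1 - x) <= 1 - x ^+ n.
Proof.
move=> /andP[x0 x1]; elim: n => [|n IHn]; first by rewrite !mul0r subrr.
have : n%:R * x ^+ n <= n%:R * x ^+ n.-1.
  by case: n {IHn} => [|n]; rewrite ?mul0r // ler_wpM2l // ler_wiXn2l.
rewrite /= [x ^+ n.+1]exprSr -[n.+1]addn1 natrD.
by nra.
Qed.

Lemma filled_upper (R : realFieldType) (q : R) (n m j : nat) :
  0 <= q < 1 -> (j <= m.+1)%N ->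
  filled q n m.+1 j <= (1 - q ^+ m.+1) ^+ n *
    (1 - q ^+ n * ((1 - q ^+ m) / (1 - q ^+ m.+1)) ^+ n) ^+ j.
Proof.
move=> /andP[q0 q1].
have q1W := ltW q1; have q01 : 0 <= q <= 1 by rewrite q0.
have d1 : 0 < 1 - q ^+ m.+1 by rewrite subr_gt0 exprn_ilt1.
have c0 : 0 <= 1 - q ^+ m by rewrite subr_ge0 exprn_ile1.
have cd : 1 - q ^+ m <= 1 - q ^+ m.+1 by rewrite lerB // ler_wiXn2l.
set r := _ / _.
have r0 : 0 <= r by rewrite divr_ge0 // ltW.
have r1 : r <= 1 by rewrite ler_pdivrMr ?mul1r.
have xr : q ^+ n * r ^+ n <= 1.
  by rewrite mulr_ile1 ?exprn_ge0 ?exprn_ile1.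
elim: j => [|j IHj] jm; first by rewrite filled_j0 mulr1.
rewrite filled_col [_ ^+ j.+1]exprSr mulrA.
have IH := IHj (ltnW jm).
(* This is [filled_ratio] divided by the square of [(1 - q ^+ m.+1) ^+ n], up to one such factor
   absorbed in [r ^+ n]. *)
have ratio : r ^+ n * filled q n m.+1 j <= filled q n m j.
  rewrite -(ler_pM2l (exprn_gt0 n d1)) mulrA -exprMn mulrC.
  rewrite [(1 - _) * r]mulrC /r divfK ?gt_eqF // mulrC.
  exact: filled_ratio.
apply: le_trans (_ : filled q n m.+1 j * (1 - q ^+ n * r ^+ n) <= _).
  rewrite mulrBr mulr1 lerB // [leLHS]mulrC -mulrA ler_wpM2l //.
  by rewrite exprn_ge0.
by rewrite ler_wpM2r // subr_ge0.
Qed.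

(** * Closed forms for [P(X = 0)], [mu] and [Delta] *)

Lemma Prob_no_isolated (R : realType) (N : nat) (p : R) :
  Prob p (fun G : bigraph N => num_isolated G == 0%N) = filled (1 - p) N N N.
Proof.
rewrite Prob_no_isolatedE.
(* Group the sets [S] by size; then [q^i - q^N = q^i (1 - q^(N-i))] gives the terms of [filled]. *)
rewrite (partition_big (fun S : {set 'I_N} => inord #|S| : 'I_N.+1) predT) //=.
apply: eq_bigr => i _.
have iN : (i <= N)%N by rewrite -ltnS.
have card_i (S : {set 'I_N}) : (inord #|S| == i :> 'I_N.+1) = (#|S| == i).
  by rewrite -val_eqE /= inordK // ltnS -[X in (_ <= X)%N]card_ord max_card.
transitivity (\sum_(S in [set S : {set 'I_N} | #|S| == i])
    (-1) ^+ i * ((1 - p) ^+ i - (1 - p) ^+ N) ^+ N).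
  by apply: eq_big => [S|S]; rewrite ?inE card_i // => /eqP ->.
rewrite sumr_const card_draws card_ord -[LHS]mulr_natl -!mulrA.
congr (_ * (_ * _)).
by rewrite mulnC exprM -exprMn mulrBr mulr1 -exprD subnKC.
Qed.

Lemma muN (R : realType) (N : nat) (p : R) :
  mu N p = 2 * N%:R * (1 - p) ^+ N.
Proof.
have EI (v : vertex N) : Expect p (isol_ind R v) = (1 - p) ^+ N.
  rewrite -(@Prob_isolated R N p v) /Prob big_mkcond /Expect.
  apply: eq_bigr => G _; rewrite /isol_ind; case: isolated;
    rewrite ?mulr1 ?mulr0 ?eqxx //.
  by rewrite eq_sym oner_eq0.
rewrite muE; under eq_bigr do rewrite EI.
by rewrite sumr_const card_sum card_ord mulrnDr -[_ *+ N]mulr_natl; ring.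
Qed.

(** A row and a column share exactly one pair, so [N + (N - 1)] pairs must be absent for both to be
    isolated. *)
Lemma DeltaN (R : realType) (N : nat) (p : R) :
  Delta N p = 2 * N%:R ^+ 2 * ((1 - p) ^+ N * (1 - p) ^+ N.-1).
Proof.
have EI (i j : 'I_N) :
    Expect p (fun G => isol_ind R (inl i) G * isol_ind R (inr j) G)
    = (1 - p) ^+ N * (1 - p) ^+ N.-1.
  transitivity (Expect p (fun G : bigraph N =>
      (\prod_(k in [set i]) isol_ind R (inl k) G) *
      \prod_(k in [set j]) isol_ind R (inr k) G)).
    by apply: eq_bigr => G _; rewrite /= !big_set1.
  rewrite Expect_isol_ind_sets (bigD1 j) //= inE eqxx; congr (_ * _).
  rewrite (eq_bigr (fun=> 1 - p)); last first.
    by move=> k /negbTE nkj; rewrite inE nkj cards1.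
  by rewrite prodr_const; congr (_ ^+ _); rewrite cardC1 card_ord.
have EI' (i j : 'I_N) :
    Expect p (fun G => isol_ind R (inr j) G * isol_ind R (inl i) G)
    = (1 - p) ^+ N * (1 - p) ^+ N.-1.
  by rewrite -(EI i j); apply: eq_bigr => G _; rewrite [X in _ * X]mulrC.
rewrite /Delta big_sumType /=.
under eq_bigr => i _.
  rewrite big_sumType /= big_pred0_eq add0r.
  under eq_bigr do rewrite EI.
  rewrite sumr_const card_ord.
  over.
under [X in _ + X]eq_bigr => j _.
  rewrite big_sumType /= big_pred0_eq addr0.
  under eq_bigr do rewrite EI'.
  rewrite sumr_const card_ord.
  over.
by rewrite !sumr_const card_ord -!mulrnA -[_ *+ (N * N)%N]mulr_natl natrM; ring.
Qed.

(** * Estimates for logarithms and exponentials *)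

Lemma ln_tangent (R : realType) (c x : R) :
  0 < c -> 0 < x -> ln x <= ln c + (x / c - 1).
Proof.
move=> c0 x0; rewrite -{1}(divfK (lt0r_neq0 c0) x) lnM ?posrE ?divr_gt0 //.
rewrite addrC lerD2l; have := @le_ln1Dx R (x / c - 1).
rewrite [1 + _]addrC subrK; apply.
by rewrite ltrBrDr addNr divr_gt0.
Qed.

(** Since [1 - t <= exp(-t)], a lower bound on a logarithm reduces to rational arithmetic. *)
Lemma mulrn_le_ln (R : realType) (x t : R) (n : nat) :
  0 < x -> 0 < 1 - t -> 1 <= x * (1 - t) ^+ n -> t *+ n <= ln x.
Proof.
move=> x0 t1 H.
have : 0 <= ln (x * (1 - t) ^+ n) by rewrite ln_ge0.
rewrite lnM ?posrE ?exprn_gt0 // lnXn //.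
have : ln (1 - t) *+ n <= (- t) *+ n.
  by rewrite ler_wMn2r // le_ln1Dx //; lra.
by rewrite mulNrn; lra.
Qed.

Lemma ln2_ge (R : realType) : 2 / 3 <= ln 2 :> R.
Proof.
(* Here [10 / 15 = 2 / 3], and [2 (14/15)^10] is just above 1. *)
have := @mulrn_le_ln R 2 (1 / 15) 10; rewrite -mulr_natr => H.
by apply: le_trans (H _ _ _); lra.
Qed.

Lemma ln3_ge (R : realType) : 1 <= ln 3 :> R.
Proof.
have := @mulrn_le_ln R 3 (1 / 6) 6; rewrite -mulr_natr => H.
by apply: le_trans (H _ _ _); lra.
Qed.

Lemma ln_1D_ge_half (R : realType) (y : R) : 1 <= y <= 2 -> y / 2 <= ln (1 + y).
Proof.
move=> y12; have y0 : 0 < 1 + y by lra.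
(* The tangent at [1 + y], evaluated at 3: with [ln 3 >= 1] the claim becomes
   [(y - 1) (y - 2) <= 0]. *)
have := @ln_tangent R (1 + y) 3 y0 ltac:(lra).
have := ln3_ge R; set z := 3 / (1 + y).
have zE : z * (1 + y) = 3 by rewrite /z divfK // lt0r_neq0.
nra.
Qed.

(** Bounding [exp(-x^2)] by [1 / (1 + x^2)] and [exp(-x)] by [(1 + x/4)^(-4)] leaves a polynomial
    inequality. At [x = 1/2] it is nearly tight, and [(1 + x/3)^3] would not suffice. *)
Lemma expR_quadratic_le (R : realType) (x : R) :
  0 <= x <= 1 / 2 -> expR (- x - x ^+ 2) <= 1 - x.
Proof.
move=> x12; rewrite expRD.
have inv_ge (y : R) : 0 <= y -> expR (- y) * (1 + y) <= 1.
  move=> y0; rewrite -[X in _ <= X](expRxMexpNx_1 y) [leRHS]mulrC.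
  rewrite ler_wpM2l ?expR_ge0 //.
  exact: expR_ge1Dx.
have e2 : expR (- x ^+ 2) * (1 + x ^+ 2) <= 1 by apply: inv_ge => //; nra.
have e1 : expR (- x) * (1 + x / 4) ^+ 4 <= 1.
  have -> : - x = 4%:R * - (x / 4) by field.
  rewrite expRM_natl -exprMn exprn_ile1 //; last by apply: inv_ge => //; lra.
  by rewrite mulr_ge0 ?expR_ge0 //; lra.
have poly : 1 <= (1 - x) * ((1 + x ^+ 2) * (1 + x / 4) ^+ 4).
  have x2 : x ^+ 2 <= x / 2 by nra.
  have x3 : x ^+ 3 <= x / 4 by rewrite exprS; nra.
  have x4 : 0 <= x ^+ 4 by rewrite exprn_ge0; lra.
  have x5 : 0 <= x ^+ 5 by rewrite exprn_ge0; lra.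
  nra.
rewrite -(@ler_pM2r _ ((1 + x ^+ 2) * (1 + x / 4) ^+ 4)); last first.
  by rewrite mulr_gt0 ?exprn_gt0 //; nra.
apply: le_trans poly; rewrite [X in _ * X]mulrC mulrACA mulr_ile1 //.
  by rewrite mulr_ge0 ?expR_ge0 ?exprn_ge0 //; lra.
by rewrite mulr_ge0 ?expR_ge0 //; nra.
Qed.

(* With [x], [b] and [rho] as in the header, this is the upper bound for a
   single row and a single column. *)
Lemma row_column_le_expR (R : realType) (x b rho : R) :
  0 < x < 1 -> 0 < b -> x * (1 - x) <= b -> b <= 1 - x ->
  0 <= rho -> 1 - rho <= b / (1 - x) ->
  (1 - x) * (1 - x * rho) <= expR (- (2 * x) * (1 - b * ln (1 + 1 / b))).
Proof.
move=> x01 b0 b_ge b_le rho0 rho_ge.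
set L := ln (1 + 1 / b).
have u0 : 0 < 1 - x by lra.
have [x12|x12] := leP x (1 / 2).
  (* As [b <= 1 - x] and [1 / (1 - x)] lies in [[1, 2]], [ln_1D_ge_half] applies; it yields
     [1 - rho <= 2 b L], which is all the exponent needs. *)
  have L_ge : 1 / (1 - x) <= 2 * L.
    apply: le_trans (_ : 2 * ln (1 + 1 / (1 - x)) <= _).
      have : 1 <= 1 / (1 - x) <= 2.
        by rewrite ler_pdivlMr // ler_pdivrMr //; lra.
      by move/ln_1D_ge_half; lra.
    rewrite ler_pM2l // ler_ln ?posrE ?addr_gt0 ?divr_gt0 // lerD2l.
    by rewrite !div1r lef_pV2 ?posrE.
  have rho_ge' : 1 - rho <= 2 * (b * L).
    by apply: le_trans rho_ge _; move: L_ge; rewrite div1r; nra.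
  apply: (@le_trans _ _ (expR (- x) * expR (- (x * rho)))).
    have := expR_ge1Dx (- x); have := expR_ge1Dx (- (x * rho)).
    have := expR_ge0 (- x); have := expR_ge0 (- (x * rho)); nra.
  by rewrite -expRD ler_expR; nra.
apply: (@le_trans _ _ (1 - x)); first by rewrite ger_pMr //; nra.
rewrite -{1}(lnK (x := 1 - x)) ?posrE // ler_expR.
have ln4 : ln 4 = 2 * ln 2 :> R.
  by rewrite -[4]/(2 * 2)%:R natrM lnM ?posrE //; lra.
have ln_half : ln (1 - x) <= - ln 2 + (2 * (1 - x) - 1).
  have := @ln_tangent R (2^-1) (1 - x) ltac:(lra) u0.
  by rewrite invrK lnV ?posrE //; lra.
have ln_quarter : ln (1 - x) <= - (2 * ln 2) + (4 * (1 - x) - 1).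
  have := @ln_tangent R (4^-1) (1 - x) ltac:(lra) u0.
  by rewrite invrK lnV ?posrE // ln4; lra.
have ln2 := ln2_ge R.
suff : ln (1 - x) + 2 * x <= 2 * x * (b * L) by lra.
have Lpos : forall c : R, 0 < c -> c * b <= 1 -> ln (1 + c) <= L.
  move=> c c0 cb; rewrite ler_ln ?posrE ?addr_gt0 ?divr_gt0 // lerD2l.
  by rewrite ler_pdivlMr.
have [b13|b13] := leP b (1 / 3).
  have L43 : 4 / 3 <= L.
    apply: le_trans (Lpos 3 _ _); [|by []|lra].
    by rewrite (_ : 1 + 3 = 4 :> R) ?ln4; lra.
  have bL : 4 / 3 * (x * (1 - x)) <= b * L by nra.
  have : 2 * x * (4 / 3 * (x * (1 - x))) <= 2 * x * (b * L).
    by rewrite ler_pM2l; lra.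
  (* The tangent at [1/2] requires [8 x^2 (1 - x) >= 1], which factors as below; its quadratic
     factor stays positive until just beyond [4/5]. Past that the tangent at [1/4] is used. *)
  have [x45|x45] := leP x (4 / 5).
    have : 0 <= (2 * x - 1) * (1 + 2 * x - 4 * x ^+ 2) by apply: mulr_ge0; nra.
    by set V := b * L; lra.
  have : 0 <= (x ^+ 2 - 16 / 25) * (1 - x) by apply: mulr_ge0; nra.
  by set V := b * L; lra.
(* Here [b <= 1 - x < 1/2], so [1 / b >= 2] and [L >= ln 3]. *)
have L1 : 1 <= L.
  apply: le_trans (Lpos 2 _ _); [|by []|lra].
  by rewrite (_ : 1 + 2 = 3 :> R) ?ln3_ge; lra.
have bL : 1 / 3 <= b * L by nra.
by set V := b * L in bL *; nra.
Qed.

(** * The two bounds on [P(X = 0)] *)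

Lemma Prob_no_isolated_le (R : realType) (N : nat) (p : R) :
  (1 <= N)%N -> 0 < p -> p < 1 ->
  Prob p (fun G : bigraph N => num_isolated G == 0%N)
    <= expR (- mu N p
             + Delta N p * p * ln (1 + mu N p / (Delta N p * p))).
Proof.
case: N => // n _ p0 p1; set N := n.+1; set q := 1 - p.
have q0 : 0 < q by rewrite subr_gt0.
have q1 : q < 1 by rewrite /q; lra.
have q01 : 0 <= q <= 1 by rewrite !ltW.
have N0 : 0 < N%:R :> R by rewrite ltr0n.
set x := q ^+ N; set b := N%:R * q ^+ n * p.
have x0 : 0 < x by rewrite exprn_gt0.
have x1 : x < 1 by rewrite exprn_ilt1 // ltW.
have u0 : 0 < 1 - x by rewrite subr_gt0.
have b0 : 0 < b by rewrite !mulr_gt0 ?exprn_gt0.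
have muE : mu N p = 2 * N%:R * x by rewrite muN.
have DpE : Delta N p * p = 2 * N%:R * x * b.
  by rewrite DeltaN /= -/q -/x /b; ring.
have -> : mu N p / (Delta N p * p) = 1 / b.
  by rewrite DpE muE; field; rewrite !gt_eqF.
rewrite DpE muE.
set c := 1 - q ^+ n.
have c0 : 0 <= c by rewrite subr_ge0 exprn_ile1 ?ltW.
set rho := (c / (1 - x)) ^+ N.
(* Because [q^n = q^n (q + p) = x + b / N]. *)
have cE : c = 1 - x - b / N%:R.
  rewrite /c /x /b exprS (_ : p = 1 - q); last by rewrite /q; ring.
  by field; rewrite gt_eqF.
have rho0 : 0 <= rho by rewrite exprn_ge0 // divr_ge0 // ltW.
have r01 : 0 <= c / (1 - x) <= 1.
  rewrite divr_ge0 ?(ltW u0) //= ler_pdivrMr // mul1r cE lerBlDr lerDl.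
  by rewrite divr_ge0 ?ltW.
have rho1 : rho <= 1 by case/andP: r01 => ? ?; rewrite exprn_ile1.
have rho_ge : 1 - rho <= b / (1 - x).
  apply: le_trans (one_sub_expn_le N r01) _.
  rewrite cE le_eqVlt; apply/orP; left; apply/eqP; field.
  by rewrite !gt_eqF.
have b_le : b <= 1 - x.
  by rewrite /b (_ : p = 1 - q) ?one_sub_expn_ge //; rewrite /q; ring.
(* Multiply [x <= q^n] by [1 - x <= N p]. *)
have b_ge : x * (1 - x) <= b.
  have := one_sub_expn_le N q01.
  rewrite -/x (_ : 1 - q = p); last by rewrite /q; ring.
  move=> u_le; apply: le_trans (_ : q ^+ n * (N%:R * p) <= _); last first.
    by rewrite /b; lra.
  apply: ler_pM => //; [exact: ltW|exact: ltW|].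
  by rewrite /x exprS ger_pMl ?exprn_gt0 // ltW.
have x01 : 0 < x < 1 by rewrite x0.
have := row_column_le_expR x01 b0 b_ge b_le rho0 rho_ge.
set e := - (2 * x) * _ => pair_bound.
(* The exponent is [N] times that for one row and one column, so it is enough to compare [N]-th
   roots. *)
rewrite (_ : - _ + _ = N%:R * e); last by rewrite /e; ring.
rewrite expRM_natl Prob_no_isolated.
have q_lt1 : 0 <= q < 1 by rewrite ltW.
apply: le_trans (@filled_upper _ _ N n N q_lt1 (leqnn _)) _.
rewrite -exprMn lerXn2r ?nnegrE ?expR_ge0 //.
by rewrite mulr_ge0 ?subr_ge0 ?(ltW x1) // mulr_ile1 // ltW.
Qed.

Lemma Prob_no_isolated_ge (R : realType) (N : nat) (p : R) :
  (1 <= N)%N -> 0 < p -> p < 1 -> (1 - p) ^+ N <= 1 / 2 ->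
  expR (- mu N p - (mu N p) ^+ 2 / (2 * N%:R))
    <= Prob p (fun G : bigraph N => num_isolated G == 0%N).
Proof.
move=> N1 p0 p1; set q := 1 - p => x12.
have q0 : 0 <= q by rewrite subr_ge0 ltW.
have q1 : q <= 1 by rewrite /q; lra.
have N0 : N%:R != 0 :> R by rewrite pnatr_eq0 -lt0n.
rewrite Prob_no_isolated; apply: le_trans (filled_lower N q0 q1 (leqnn N)).
rewrite muN -/q; set x := q ^+ N in x12 *.
have x0 : 0 <= x by rewrite exprn_ge0.
(* With [mu = 2 N x], the term [mu^2 / (2 N)] is [2 N x^2]: each of the [2 N] vertices contributes
   [- x - x^2]. *)
rewrite (_ : - _ - _ = N%:R * (2%:R * (- x - x ^+ 2))); last by field.
rewrite 2!expRM_natl -exprMn -expr2.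
have u0 : 0 <= 1 - x by lra.
apply: lerXn2r; rewrite ?nnegrE ?exprn_ge0 ?expR_ge0 //.
apply: lerXn2r; rewrite ?nnegrE ?expR_ge0 //.
by apply: expR_quadratic_le; rewrite x0.
Qed.

Theorem theorem2 (R : realType) (N : nat) (p : R)
    (N_ge1 : (1 <= N)%N) (p_gt0 : 0 < p) (p_lt1 : p < 1) :
  Prob p (fun G : bigraph N => num_isolated G == 0%N)
    <= expR (- mu N p
             + Delta N p * p * ln (1 + mu N p / (Delta N p * p)))
  /\
  (forall v : vertex N,
     Prob p (fun G : bigraph N => isol_ind R v G == 1) <= 1 / 2 ->
     expR (- mu N p - (mu N p) ^+ 2 / (2 * N%:R))
       <= Prob p (fun G : bigraph N => num_isolated G == 0%N)).
Proof.
split; first exact: Prob_no_isolated_le.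
by move=> v; rewrite Prob_isolated; exact: Prob_no_isolated_ge.
Qed.
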